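(* Let $r\geq2$ and let $\varphi=(\varphi_0,\ldots,\varphi_r):\mathbb P^r\dashrightarrow\mathbb P^r$ be a Cremona transformation of bidegree $(2,2)$ over $\mathbb C$. Let $B$, respectively $B'$, be the base locus (scheme) of $\varphi$, respectively of $\varphi^{-1}$. Then $B$ and $B'$ are projectively equivalent.
   Context: A Cremona transformation of $\mathbb P^r$ is a birational map $\mathbb P^r\dashrightarrow\mathbb P^r$. It is of bidegree (or type) $(2,2)$, also called quadro-quadric, if it is given by quadratic forms $\varphi_0,\ldots,\varphi_r$ without a common factor and its inverse is also given by quadratic forms without a common factor. The base locus of $\varphi$ is the subscheme $V(\varphi_0,\ldots,\varphi_r)\subset\mathbb P^r$. *)

(* Defs.v *)
From HB Require Import structures.
From mathcomp Require Import all_boot all_order all_algebra.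
From mathcomp Require Import reals complex mpoly.

Set Implicit Arguments.
Unset Strict Implicit.
Unset Printing Implicit Defensive.

Import GRing.Theory.
Local Open Scope ring_scope.

Section Projective.
Variable K : fieldType.

(** Rational maps P^r ⇢ P^r are represented by (r+1)-tuples of forms of the
    same degree, not all zero, in the homogeneous coordinates
    'X_0, ..., 'X_r. *)

(* With all entries 0, every polynomial would be a common divisor, so the
   last condition also forces the tuple to be nonzero. *)
Definition reduced_forms (r d : nat) (phi : (r.+1).-tuple {mpoly K[r.+1]}) : Prop :=
  (forall i : 'I_r.+1, tnth phi i \is d.-homog) /\
  (forall g : {mpoly K[r.+1]},
     (forall i : 'I_r.+1, exists q : {mpoly K[r.+1]}, tnth phi i = q * g) ->
     g \is a GRing.unit).

Definition nonzero_tuple (r : nat) (phi : (r.+1).-tuple {mpoly K[r.+1]}) : Prop :=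
  exists i : 'I_r.+1, tnth phi i != 0.

Definition rat_map_eq (r : nat) (phi psi : (r.+1).-tuple {mpoly K[r.+1]}) : Prop :=
  [/\ nonzero_tuple phi, nonzero_tuple psi &
      forall i j : 'I_r.+1,
        tnth phi i * tnth psi j = tnth phi j * tnth psi i].

Definition rat_map_id (r : nat) : (r.+1).-tuple {mpoly K[r.+1]} :=
  [tuple 'X_i | i < r.+1].

(* psi o phi; it is defined as a rational map iff this tuple is nonzero, a
   condition which is part of rat_map_eq. *)
Definition rat_map_comp (r : nat) (psi phi : (r.+1).-tuple {mpoly K[r.+1]}) :
    (r.+1).-tuple {mpoly K[r.+1]} :=
  [tuple tnth psi i \mPo phi | i < r.+1].

Definition rat_map_inverse (r : nat) (phi psi : (r.+1).-tuple {mpoly K[r.+1]}) : Prop :=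
  rat_map_eq (rat_map_comp psi phi) (rat_map_id r) /\
  rat_map_eq (rat_map_comp phi psi) (rat_map_id r).

(* phi is a Cremona transformation of bidegree (d, e), and psi is the tuple of
   forms without common factor (unique up to a nonzero scalar) giving its
   inverse. *)
Definition cremona_bidegree (r d e : nat)
    (phi psi : (r.+1).-tuple {mpoly K[r.+1]}) : Prop :=
  [/\ reduced_forms d phi, reduced_forms e psi & rat_map_inverse phi psi].

(** Closed subschemes of P^r are given by tuples of forms F, standing for V(F),
    and are compared through their ideals on the standard affine charts. *)

(* Restriction to the chart {'X_i <> 0}, identified with A^r: the i-th
   homogeneous coordinate is set to 1, and the remaining ones become, in order,
   the r affine coordinates. *)
Definition dehomog (r : nat) (i : 'I_r.+1) (p : {mpoly K[r.+1]}) : {mpoly K[r]} :=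
  p \mPo [tuple if unlift i j is Some k then 'X_k else 1 | j < r.+1].

Definition chart_ideal (r m : nat) (F : m.-tuple {mpoly K[r.+1]}) (i : 'I_r.+1)
    (f : {mpoly K[r]}) : Prop :=
  exists c : 'I_m -> {mpoly K[r]},
    f = \sum_(k < m) c k * dehomog i (tnth F k).

Definition same_subscheme (r m n : nat)
    (F : m.-tuple {mpoly K[r.+1]}) (G : n.-tuple {mpoly K[r.+1]}) : Prop :=
  forall (i : 'I_r.+1) (f : {mpoly K[r]}), chart_ideal F i f <-> chart_ideal G i f.

(* Equations of the inverse image of V(F) under x |-> A x, x a column vector. *)
Definition linear_pullback (r m : nat) (A : 'M[K]_r.+1)
    (F : m.-tuple {mpoly K[r.+1]}) : m.-tuple {mpoly K[r.+1]} :=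
  [tuple tnth F k \mPo [tuple \sum_(j < r.+1) A i j *: 'X_j | i < r.+1] | k < m].

(* For A invertible, the condition says that x |-> A x maps V(F) onto V(G). *)
Definition projectively_equivalent (r m n : nat)
    (F : m.-tuple {mpoly K[r.+1]}) (G : n.-tuple {mpoly K[r.+1]}) : Prop :=
  exists2 A : 'M[K]_r.+1, A \in unitmx & same_subscheme F (linear_pullback A G).

End Projective.

(* Main.v *)
Require Import Defs.
From HB Require Import structures.
From mathcomp Require Import all_boot all_order all_algebra.
From mathcomp Require Import reals complex mpoly.
From mathcomp Require Import perm boolp ring.

Import GRing.Theory Num.Theory.
Local Open Scope ring_scope.

Set Implicit Arguments.
Unset Strict Implicit.
Unset Printing Implicit Defensive.

(** Write [x * y] and [x *' y] for the polarizations of [phi] and [phi'], and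
    [N1 a y], [M1 b w] for the derivatives of the cubic forms with
    [phi' (phi x) = N x x] and [phi (phi' y) = M y y].  Linearizing these
    identities reduces the relation [phi' (A y) = L (phi y)], for the linear maps
    [A y = N1 a y phi a - N a (a * y)] and
    [L w = M1 (phi a) w phi' (phi a) - M (phi a) (phi a *' w)], to
    [M1 (phi a) (phi y) = N a N1 y a].  That identity follows by linearization
    once the trace [a |-> M1 (phi a) w / N a] is known to be linear.  The trace
    multiplies [phi] into a cubic map; if [phi] maps the line through [a] and [y]
    onto a conic, comparing degrees along that line forces the trace to be affine
    there.  If no line has a conic as its image, then [phi] is a linear form times
    a linear map, against the absence of common factors.  Since [A] and [L] are
    invertible when [N a <> 0], the forms [phi' (A y)] span the same space as the
    forms [phi]. *)

(** * Polynomial identities over an infinite field *)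

Section PolynomialIdentities.
Variable K : numFieldType.

Lemma poly_fun_eq0 (p : {poly K}) : (forall t, p.[t] = 0) -> p = 0.
Proof.
move=> p0; apply/eqP/negPn/negP => pN0.
pose s := [seq i%:R | i <- iota 0 (size p)] : seq K.
have: (size s < size p)%N.
  apply: max_poly_roots => //; first by apply/allP => t _; rewrite rootE p0.
  by rewrite map_inj_uniq ?iota_uniq //; apply: mulrIn; rewrite oner_neq0.
by rewrite size_map size_iota ltnn.
Qed.

(** On an explicit list [horner_rec] reduces to a nested expression that [ring] understands, so an
    identity in a parameter t can be compared coefficient by coefficient. *)
Lemma coef_fun_eq0 (s : seq K) :
  (forall t, horner_rec s t = 0) -> forall i, s`_i = 0.
Proof.
move=> s0 i; rewrite -coef_Poly (@poly_fun_eq0 (Poly s)) ?coef0 // => t.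
by rewrite horner_Poly.
Qed.

Lemma mul_fun_eq0 (p q : {poly K}) :
  p != 0 -> (forall t, p.[t] * q.[t] = 0) -> q = 0.
Proof.
move=> p0 pq; have /eqP : p * q = 0 by apply: poly_fun_eq0 => t; rewrite hornerM.
by rewrite mulf_eq0 (negPf p0) => /eqP.
Qed.

Lemma mwiden_muniK n (p : {mpoly K[n.+1]}) :
  (map_poly (@mwiden n K) (muni p)).['X_ord_max] = p.
Proof.
rewrite muniE rmorph_sum /= horner_sum [RHS]mpolyE; apply: eq_bigr => m _.
rewrite -!mul_polyC !rmorphM /= !map_polyC /= map_polyXn.
rewrite !hornerE mwidenZ mwidenX -scalerAl; congr (_ *: _).
rewrite mpolyXn -mpolyXD; congr 'X_[_].
apply/mnmP => i; rewrite mnmDE mulmnE mnm1E.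
case: (unliftP ord_max i) => [j ->|->]; last first.
  by rewrite mnmwiden_ordmax eqxx mul1n.
have -> : lift ord_max j = widen_ord (leqnSn n) j.
  by apply: val_inj; rewrite /= /bump leqNgt ltn_ord.
rewrite mnmwiden_widen mnmE.
case: eqP => [/(congr1 val)/= e|_]; last by rewrite mul0n addn0.
by have := ltn_ord j; rewrite -e ltnn.
Qed.

Lemma meval_mwiden n (p : {mpoly K[n]}) v :
  (mwiden p).@[v] = p.@[v \o widen_ord (leqnSn n)].
Proof.
have -> : mwiden p = p \mPo [tuple 'X_(widen_ord (leqnSn n) i) | i < n].
  apply: eq_bigr => m _; congr (_ * _); apply: eq_bigr => i _.
  by rewrite tnth_mktuple.
rewrite comp_mpoly_meval; apply: meval_eq => i /=.
by rewrite tnth_mktuple mevalXU.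
Qed.

(** Induction on the number of variables: [muni] views [p] as a polynomial in the last variable, and
    its coefficients, evaluated at [v], vanish by the one-variable case. *)
Lemma mpoly_fun_eq0 n (p : {mpoly K[n]}) : (forall v, p.@[v] = 0) -> p = 0.
Proof.
elim: n p => [p p0|n IH p p0].
  by have := p0 (fun=> 0); rewrite (nvar0_mpolyC p) mevalC => ->; rewrite mpolyC0.
rewrite -(mwiden_muniK p).
suff -> : muni p = 0 by rewrite map_poly0 horner0.
apply/polyP => k; rewrite coef0; apply: IH => v.
rewrite -(coef_map (meval v)) /=.
suff -> : map_poly (meval v) (muni p) = 0 by rewrite coef0.
apply: poly_fun_eq0 => t.
pose w i := if unlift ord_max i is Some j then v j else t.
rewrite -[RHS](p0 w) -[in RHS](mwiden_muniK p).
elim/poly_ind: (muni p) => [|q c IHq].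
  by rewrite !map_poly0 !horner0 meval0.
rewrite !rmorphD !rmorphM /= !map_polyX !map_polyC /= !hornerE IHq.
rewrite mevalD mevalM mevalXU {3}/w unlift_none; congr (_ + _).
rewrite meval_mwiden; apply: meval_eq => i /=.
have -> : widen_ord (leqnSn n) i = lift ord_max i.
  by apply: val_inj; rewrite /= /bump leqNgt ltn_ord.
by rewrite /w liftK.
Qed.

End PolynomialIdentities.

(** * Quadratic maps and cubic forms *)

(** [B] is the polarization without the factor 1/2, so [B x x = 2 *: phi x]. *)
Definition quadratic_map (K : numFieldType) (n : nat)
    (phi : 'rV[K]_n -> 'rV[K]_n) (B : 'rV[K]_n -> 'rV[K]_n -> 'rV[K]_n) :=
  [/\ forall x y t, phi (x + t *: y) = phi x + t *: B x y + t ^+ 2 *: phi y,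
      forall x y, B x y = B y x
    & forall x t y z, B x (t *: y + z) = t *: B x y + B x z].

(** [N1 x y] is the derivative of [N] at [x] in the direction [y]. Its linearity in [y] is derived
    later, in [cubic_diff_linear]. *)
Definition cubic_form (K : numFieldType) (n : nat)
    (N : 'rV[K]_n -> K) (N1 : 'rV[K]_n -> 'rV[K]_n -> K) :=
  (forall t x, N (t *: x) = t ^+ 3 * N x) /\
  (forall x y t,
     N (x + t *: y) = N x + t * N1 x y + t ^+ 2 * N1 y x + t ^+ 3 * N y).

(** Deduces a goal from a known equation, leaving an identity for [ring] or [field]. *)
Lemma eq_of_eqB (V : zmodType) (x y u v : V) : u = v -> x - y = u - v -> x = y.
Proof. by move=> -> /eqP; rewrite subrr subr_eq0 => /eqP. Qed.

Section Quadratic.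
Variables (K : numFieldType) (n : nat).
Local Notation V := 'rV[K]_n.
Variables (phi : V -> V) (B : V -> V -> V).
Hypothesis phiB : quadratic_map phi B.

Lemma quadE x y t : phi (x + t *: y) = phi x + t *: B x y + t ^+ 2 *: phi y.
Proof. by case: phiB. Qed.

Lemma polarC x y : B x y = B y x.
Proof. by case: phiB. Qed.

Lemma polarPr x t y z : B x (t *: y + z) = t *: B x y + B x z.
Proof. by case: phiB. Qed.

Lemma polar0r x : B x 0 = 0.
Proof.
have := polarPr x 1 0 0; rewrite !scale1r addr0 => /eqP.
by rewrite -subr_eq0 opprD addNKr oppr_eq0 => /eqP.
Qed.

Lemma polarDr x y z : B x (y + z) = B x y + B x z.
Proof. by rewrite -[y]scale1r polarPr !scale1r. Qed.

Lemma polarZr x t y : B x (t *: y) = t *: B x y.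
Proof. by rewrite -[t *: y]addr0 polarPr polar0r addr0. Qed.

Lemma polarDl x y z : B (x + y) z = B x z + B y z.
Proof. by rewrite !(polarC _ z) polarDr. Qed.

Lemma polarZl t x y : B (t *: x) y = t *: B x y.
Proof. by rewrite !(polarC _ y) polarZr. Qed.

Lemma quad0 : phi 0 = 0.
Proof.
have := quadE 0 0 1; rewrite scale1r addr0 polar0r scaler0 addr0 expr1n scale1r.
by move=> /eqP; rewrite -subr_eq0 opprD addNKr oppr_eq0 => /eqP.
Qed.

Lemma quadZ t x : phi (t *: x) = t ^+ 2 *: phi x.
Proof. by rewrite -[t *: x]add0r quadE quad0 polarC polar0r scaler0 !add0r. Qed.

Lemma polar_diag x : B x x = 2 *: phi x.
Proof.
have := quadE x x 1; rewrite -[X in X + 1 *: x]scale1r -scalerDl quadZ => E.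
apply/rowP => i; move/rowP: E => /(_ i); rewrite !mxE => E.
by apply: (eq_of_eqB (esym E)); ring.
Qed.

End Quadratic.

Section Cubic.
Variables (K : numFieldType) (n : nat).
Local Notation V := 'rV[K]_n.
Variables (N : V -> K) (N1 : V -> V -> K).
Hypothesis NN1 : cubic_form N N1.

Lemma cubicE x y t :
  N (x + t *: y) = N x + t * N1 x y + t ^+ 2 * N1 y x + t ^+ 3 * N y.
Proof. by case: NN1. Qed.

Lemma cubicZ t x : N (t *: x) = t ^+ 3 * N x.
Proof. by case: NN1. Qed.

Lemma cubic_diff_diag x : N1 x x = 3 * N x.
Proof.
have := cubicE x x 1; rewrite -[X in X + 1 *: x]scale1r -scalerDl cubicZ => E.
have two0 : (2 : K) != 0 by rewrite pnatr_eq0.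
by apply: (mulfI two0); apply: (eq_of_eqB (esym E)); ring.
Qed.

End Cubic.

Section Core.
Variables (K : numFieldType) (n : nat).
Local Notation V := 'rV[K]_n.
Variables (phi phi' : V -> V) (B B' : V -> V -> V).
Variables (N M : V -> K) (N1 M1 : V -> V -> K).
Hypothesis phiB : quadratic_map phi B.
Hypothesis phiB' : quadratic_map phi' B'.
Hypothesis NN1 : cubic_form N N1.
Hypothesis phi'K : forall x, phi' (phi x) = N x *: x.

(** These are the coefficients of t and t^2 in [phi' (phi x) = N x *: x] at [x = a + t *: y]. *)
Lemma inverse_expansion a y :
  B' (phi a) (B a y) = N1 a y *: a + N a *: y /\
  phi' (B a y) + B' (phi a) (phi y) = N1 a y *: y + N1 y a *: a.
Proof.
suff E i : (B' (phi a) (B a y) - (N1 a y *: a + N a *: y)) 0 i = 0 /\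
  (phi' (B a y) + B' (phi a) (phi y) - (N1 a y *: y + N1 y a *: a)) 0 i = 0.
  by split; apply/subr0_eq/rowP => i; have [e1 e2] := E i; rewrite [RHS]mxE.
pose c0 := (phi' (phi a) - N a *: a) 0 i.
pose c1 := (B' (phi a) (B a y) - (N1 a y *: a + N a *: y)) 0 i.
pose c2 := (phi' (B a y) + B' (phi a) (phi y) -
  (N1 a y *: y + N1 y a *: a)) 0 i.
pose c3 := (B' (B a y) (phi y) - (N1 y a *: y + N y *: a)) 0 i.
pose c4 := (phi' (phi y) - N y *: y) 0 i.
have /coef_fun_eq0 c : forall t, horner_rec [:: c0; c1; c2; c3; c4] t = 0.
  move=> t; have /rowP/(_ i) := phi'K (a + t *: y).
  (* The value is grouped as [phi a + t *: (B a y + t *: phi y)], so that [quadE phiB'] applies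
     twice. *)
  rewrite (quadE phiB) expr2 -scalerA -addrA -scalerDr.
  rewrite !(quadE phiB') (polarDr phiB') (polarZr phiB').
  rewrite (cubicE NN1) !mxE /= => E.
  by apply: (eq_of_eqB E); rewrite /c0 /c1 /c2 /c3 /c4 !mxE; ring.
by split; [exact: (c 1%N)|exact: (c 2%N)].
Qed.

End Core.

(** * Pairs of inverse quadratic maps *)

(** By [inverse_expansion], [N1 a y *: a] is [B' (phi a) (B a y) - N a *: y], which is linear in
    [y]; and [a] is nonzero. *)
Lemma cubic_diff_linear (K : numFieldType) (n : nat)
    (phi phi' : 'rV[K]_n -> 'rV[K]_n) (B B' : 'rV[K]_n -> 'rV[K]_n -> 'rV[K]_n)
    (N : 'rV[K]_n -> K) (N1 : 'rV[K]_n -> 'rV[K]_n -> K) a :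
  quadratic_map phi B -> quadratic_map phi' B' -> cubic_form N N1 ->
  (forall x, phi' (phi x) = N x *: x) -> N a != 0 ->
  forall t y z, N1 a (t *: y + z) = t * N1 a y + N1 a z.
Proof.
move=> phiB phiB' NN1 phi'K Na t y z.
have a0 : a != 0.
  by apply: contraNneq Na => ->; rewrite -(scale0r 0) (cubicZ NN1) expr0n mul0r.
have E y' := (inverse_expansion phiB phiB' NN1 phi'K a y').1.
have := E (t *: y + z).
rewrite (polarPr phiB) (polarPr phiB') !E => F.
suff /eqP : (N1 a (t *: y + z) - (t * N1 a y + N1 a z)) *: a = 0.
  by rewrite scaler_eq0 (negPf a0) orbF subr_eq0 => /eqP.
apply/rowP => i; move/rowP: F => /(_ i); rewrite !mxE => F.
apply: (eq_of_eqB (esym F)); ring.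
Qed.

Section InversePair.
Variables (K : numFieldType) (n : nat).
Local Notation V := 'rV[K]_n.
Variables (phi phi' : V -> V) (B B' : V -> V -> V).
Variables (N M : V -> K) (N1 M1 : V -> V -> K).
Hypothesis phiB : quadratic_map phi B.
Hypothesis phiB' : quadratic_map phi' B'.
Hypothesis NN1 : cubic_form N N1.
Hypothesis MM1 : cubic_form M M1.
Hypothesis phi'K : forall x, phi' (phi x) = N x *: x.
Hypothesis phiK : forall y, phi (phi' y) = M y *: y.

Lemma cubic0 : N 0 = 0.
Proof. by rewrite -(scale0r 0) (cubicZ NN1) expr0n mul0r. Qed.

Lemma quad_neq0 x : N x != 0 -> phi x != 0.
Proof.
move=> Nx; apply: contraNneq (Nx) => p0; have := phi'K x.
rewrite p0 (quad0 phiB') => /esym/eqP; rewrite scaler_eq0.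
by case/orP => // /eqP ->; rewrite cubic0.
Qed.

(** Both sides are the factor by which [phi (phi' (phi x))] differs from [phi x]; if [phi x = 0],
    both vanish. *)
Lemma norm_quad x : M (phi x) = N x ^+ 2.
Proof.
have [p0|p0] := eqVneq (phi x) 0.
  have -> : N x = 0.
    by apply/eqP; move: p0; apply: contra_eqT => /quad_neq0.
  by rewrite p0 -(scale0r 0) (cubicZ MM1) expr0n mul0r expr0n.
have := phiK (phi x); rewrite phi'K (quadZ phiB) => /eqP.
by rewrite eq_sym -subr_eq0 -scalerBl scaler_eq0 (negPf p0) orbF subr_eq0 => /eqP.
Qed.

(** The first part of [inverse_expansion] with the two maps exchanged, at the point [phi x]. *)
Lemma quad_polar_polar x w :
  N x *: B x (B' (phi x) w) = M1 (phi x) w *: phi x + N x ^+ 2 *: w.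
Proof.
have := (inverse_expansion phiB' phiB MM1 phiK (phi x) w).1.
by rewrite phi'K (polarZl phiB) norm_quad.
Qed.

(** This differentiates [M (phi x) = N x ^+ 2]; it is obtained by taking [w = B x y] in
    [quad_polar_polar] and comparing multiples of [phi x]. *)
Lemma norm_diff_polar x y : N x != 0 -> M1 (phi x) (B x y) = 2 * N x * N1 x y.
Proof.
move=> Nx; have := quad_polar_polar x (B x y).
rewrite (inverse_expansion phiB phiB' NN1 phi'K x y).1 (polarPr phiB).
rewrite (polarZr phiB) (polar_diag phiB) => F.
suff /eqP : (M1 (phi x) (B x y) - 2 * N x * N1 x y) *: phi x = 0.
  by rewrite scaler_eq0 (negPf (quad_neq0 Nx)) orbF subr_eq0 => /eqP.
apply/rowP => i; move/rowP: F => /(_ i); rewrite !mxE => F.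
apply: (eq_of_eqB (esym F)); ring.
Qed.

Definition mx3 (u v w : V) : 'M[K]_(3, n) := \matrix_(i < 3) nth 0 [:: u; v; w] i.

Lemma row_free_mx3 u v w : row_free (mx3 u v w) ->
  exists C : 'M[K]_(n, 3), [/\ u *m C = delta_mx 0 0, v *m C = delta_mx 0 1
    & w *m C = delta_mx 0 2].
Proof.
move=> /row_freeP[C E]; exists C.
have R (i : 'I_3) : nth 0 [:: u; v; w] i *m C = delta_mx 0 i.
  rewrite -[nth _ _ _](rowK (fun i : 'I_3 => nth 0 [:: u; v; w] i) i).
  by rewrite -row_mul E row1.
by split; [exact: (R 0)|exact: (R 1)|exact: (R 2)].
Qed.

(** For the adjoint map of a cubic Jordan algebra this is the trace bilinear form. *)
Definition mtrace a w := M1 (phi a) w / N a.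

(* For x on the line a + s y, the cubic map x * (phi x *' w) - N x w, with
   coefficients G0, ..., G3 in s, equals mtrace x w *: phi x.  Its coordinates f
   and g on phi a and phi y therefore satisfy g = s^2 f; both having degree at
   most 3 in s, f = mtrace x w is affine in s. *)
Lemma mtrace_affine a y w t : N a != 0 -> N y != 0 ->
  row_free (mx3 (phi a) (B a y) (phi y)) ->
  M1 (phi (a + t *: y)) w = N (a + t *: y) * (mtrace a w + t * mtrace y w).
Proof.
move=> Na Ny /row_free_mx3[C [Ca Cay Cy]].
pose f (v : V) := (v *m C) 0 0; pose g (v : V) := (v *m C) 0 2.
pose G0 := B a (B' (phi a) w) - N a *: w.
pose G1 := B a (B' (B a y) w) + B y (B' (phi a) w) - N1 a y *: w.
pose G2 := B a (B' (phi y) w) + B y (B' (B a y) w) - N1 y a *: w.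
pose G3 := B y (B' (phi y) w) - N y *: w.
pose x s := a + s *: y.
have E s : N (x s) *: (G0 + s *: G1 + s ^+ 2 *: G2 + s ^+ 3 *: G3) =
    M1 (phi (x s)) w *: (phi a + s *: B a y + s ^+ 2 *: phi y).
  rewrite -(quadE phiB) -/(x s).
  have := quad_polar_polar (x s) w.
  rewrite {2 3}/x (quadE phiB) (polarDl phiB) (polarZl phiB).
  rewrite !(polarDl phiB') !(polarZl phiB') !(polarDr phiB) !(polarZr phiB) => F.
  apply/rowP => i; move/rowP: F => /(_ i); rewrite !mxE => F.
  apply: (eq_of_eqB F); rewrite (cubicE NN1); ring.
(* [C] reads off coordinates on the free triple, where [phi (x s)] has coordinates 1, s, s^2. *)
have fgE (g0 g1 g2 g3 : V) s c d :
    c *: (g0 + s *: g1 + s ^+ 2 *: g2 + s ^+ 3 *: g3) =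
      d *: (phi a + s *: B a y + s ^+ 2 *: phi y) ->
    c * (f g0 + s * f g1 + s ^+ 2 * f g2 + s ^+ 3 * f g3) = d /\
    c * (g g0 + s * g g1 + s ^+ 2 * g g2 + s ^+ 3 * g g3) = s ^+ 2 * d.
  move=> /(congr1 (mulmx^~ C)); rewrite -!scalemxAl !mulmxDl -!scalemxAl Ca Cay Cy.
  move=> /matrixP F; have := F 0 0; have := F 0 2; rewrite !mxE /= => F2 F0.
  split; [apply: (eq_of_eqB F0)|apply: (eq_of_eqB F2)]; rewrite /f /g !mxE; ring.
have Ef s := (fgE _ _ _ _ _ _ _ (E s)).1.
have Eg s := (fgE _ _ _ _ _ _ _ (E s)).2.
pose p := Poly [:: N a; N1 a y; N1 y a; N y].
(* The coefficients of g - s^2 f. Its vanishing in degrees 3, 4, 5 gives [f G1 = g G3] and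
   [f G2 = f G3 = 0]. *)
pose q := Poly [:: g G0; g G1; g G2 - f G0; g G3 - f G1; - f G2; - f G3].
have p0 : p != 0.
  apply: contraNneq Na => /(congr1 (fun r : {poly K} => r`_0)).
  by rewrite coef_Poly coef0 /= => ->.
have q0 : q = 0.
  apply: (mul_fun_eq0 p0) => s; rewrite !horner_Poly /=.
  have := congr1 (fun z => s ^+ 2 * z) (Ef s); rewrite -Eg (cubicE NN1) => F.
  apply: (eq_of_eqB (esym F)); ring.
have qk k : q`_k = 0 by rewrite q0 coef0.
have := qk 5%N; have := qk 4%N; have := qk 3%N; rewrite !coef_Poly /=.
move=> /eqP; rewrite subr_eq0 => /eqP g3 /eqP; rewrite oppr_eq0 => /eqP f2.
move=> /eqP; rewrite oppr_eq0 => /eqP f3.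
(* The remaining coefficients are traces: [G0] is the cubic map at s = 0, and [G3] is the same
   expression at [y]. *)
have f0 : mtrace a w = f G0.
  apply: (mulfI Na); rewrite mulrC mulfVK //.
  have := Ef 0; rewrite /x scale0r addr0 => <-; ring.
have g3' : mtrace y w = g G3.
  apply: (mulfI Ny); rewrite mulrC mulfVK //.
  have := congr1 (fun v => (v *m C) 0 2) (quad_polar_polar y w).
  rewrite -!scalemxAl !mulmxDl -!scalemxAl Cy /g /G3 mulmxBl -!scalemxAl.
  by rewrite !mxE /= => F; apply: (eq_of_eqB (esym F)); ring.
rewrite -/(x t) -Ef f0 g3' f2 f3 -g3; ring.
Qed.

(** Take [w = phi x] in [mtrace_affine], with [x = a + t *: y]. Since
    [M1 (phi x) (phi x) = 3 * N x ^+ 2], the affine trace equals [3 * N x]. In degree 2 this reads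
    [mtrace a (phi y) + mtrace y (B a y) = 3 * N1 y a], and [norm_diff_polar] makes the second term
    [2 * N1 y a]. *)
Lemma norm_diff_quad_free a y : N a != 0 -> N y != 0 ->
  row_free (mx3 (phi a) (B a y) (phi y)) ->
  M1 (phi a) (phi y) = N a * N1 y a.
Proof.
move=> Na Ny fr.
have lin z : N z != 0 -> forall t u v,
    mtrace z (t *: u + v) = t * mtrace z u + mtrace z v.
  move=> Nz t u v; rewrite /mtrace.
  rewrite (cubic_diff_linear phiB' phiB MM1 phiK) ?norm_quad ?expf_neq0 //.
  by field.
have D z t : N z != 0 -> mtrace z (phi (a + t *: y)) =
    mtrace z (phi a) + t * mtrace z (B a y) + t ^+ 2 * mtrace z (phi y).
  move=> Nz; rewrite (quadE phiB) addrC [phi a + _]addrC !lin //; ring.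
pose c0 := 3 * N a - mtrace a (phi a).
pose c1 := 3 * N1 a y - mtrace a (B a y) - mtrace y (phi a).
pose c2 := 3 * N1 y a - mtrace a (phi y) - mtrace y (B a y).
pose c3 := 3 * N y - mtrace y (phi y).
pose p := Poly [:: N a; N1 a y; N1 y a; N y].
have p0 : p != 0.
  apply: contraNneq Na => /(congr1 (fun r : {poly K} => r`_0)).
  by rewrite coef_Poly coef0 /= => ->.
have q0 : Poly [:: c0; c1; c2; c3] = 0.
  apply: (mul_fun_eq0 p0) => t; rewrite !horner_Poly /=.
  have := mtrace_affine (phi (a + t *: y)) t Na Ny fr.
  rewrite (cubic_diff_diag MM1) norm_quad !D // (cubicE NN1) => F.
  apply: (eq_of_eqB F); rewrite /c0 /c1 /c2 /c3; ring.
have := congr1 (fun r : {poly K} => r`_2) q0; rewrite coef_Poly coef0 /= /c2.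
rewrite [mtrace y _]/mtrace (polarC phiB) norm_diff_polar //.
have -> : 2 * N y * N1 y a / N y = 2 * N1 y a by field.
rewrite /mtrace => F; apply: (mulIf (invr_neq0 Na)).
by apply: (eq_of_eqB (esym F)); field.
Qed.

End InversePair.

(** * Quadratic maps sending lines to lines *)

Section CommonFactor.
Variables (K : numFieldType) (n : nat).
Local Notation V := 'rV[K]_n.

Lemma row_free_mx3Pn (u v w : V) : ~~ row_free (mx3 u v w) ->
  exists p q s, [|| p != 0, q != 0 | s != 0] /\ p *: u + q *: v + s *: w = 0.
Proof.
rewrite -kermx_eq0 => /rowV0Pn[c /sub_kermxP cM c0].
exists (c 0 0), (c 0 1), (c 0 2); split.
  apply: contraR c0; rewrite !negb_or !negbK => /and3P[/eqP c0 /eqP c1 /eqP c2].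
  apply/eqP/rowP => i; rewrite mxE.
  case: i => [[|[|[|//]]] Hi].
  - by rewrite -c0; congr (c _ _); apply: val_inj.
  - by rewrite -c1; congr (c _ _); apply: val_inj.
  - by rewrite -c2; congr (c _ _); apply: val_inj.
have := cM; rewrite mulmx_sum_row !big_ord_recl big_ord0 addr0 !rowK /= addrA.
move=> <-; congr (c 0 _ *: _ + c 0 _ *: _ + c 0 _ *: _); exact: val_inj.
Qed.

(** A quadratic form vanishing on a hyperplane is divisible by its equation: [z - l z *: u] lies on
    the hyperplane. *)
Lemma quad_form_factor (q : V -> K) (b : V -> V -> K) (l : V -> K) u z :
  (forall x y t, q (x + t *: y) = q x + t * b x y + t ^+ 2 * q y) ->
  scalar l -> l u = 1 -> (forall x, l x = 0 -> q x = 0) ->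
  q z = l z * (b z u - l z * q u).
Proof.
move=> qE ll lu ql; have := qE z u (- l z).
rewrite ql => [E|]; first by apply: (eq_of_eqB (esym E)); ring.
by rewrite addrC ll lu mulr1 addNr.
Qed.

Variables (Phi : V -> V) (B : V -> V -> V) (e : V).
Hypothesis n_ge3 : (3 <= n)%N.
Hypothesis PhiB : quadratic_map Phi B.
Hypothesis Be : forall z, B e z = z.
Hypothesis dep : forall x y, ~~ row_free (mx3 (Phi x) (B x y) (Phi y)).

Lemma unit_neq0 : e != 0.
Proof.
apply/eqP => e0.
have := Be (const_mx 1); rewrite e0 (polarC PhiB) (polar0r PhiB).
move=> /rowP/(_ (Ordinal (ltn_trans (isT : 0 < 2)%N n_ge3))); rewrite !mxE => /eqP.
by rewrite eq_sym oner_eq0.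
Qed.

Lemma quad_unit : Phi e = 2^-1 *: e.
Proof.
by rewrite -[in RHS](Be e) (polar_diag PhiB) scalerA mulVf ?pnatr_eq0 // scale1r.
Qed.

(** Dependence for the pair [e], [z] makes [Phi z] parallel to [z] modulo [e]. As there are at least
    two coordinates modulo [e], one of them, [l j1], must divide [l j1 (Phi z)]; the quotient is the
    linear form [beta]. *)
Lemma common_factor_mod : exists beta alpha : V -> K,
  [/\ scalar beta, beta e = 1 & forall z, Phi z = beta z *: z + alpha z *: e].
Proof.
have [i0 ei0] : exists i, e 0 i != 0.
  apply/existsP; apply: contraR unit_neq0; rewrite negb_exists => /forallP h.
  by apply/eqP/rowP => i; rewrite mxE; apply/eqP; have := h i; rewrite negbK.
have /card_gt1P[j1 [k [+ + j1k]]] : (1 < #|[set~ i0]|)%N.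
  by rewrite cardsC1 card_ord; case: n n_ge3 => [|[|[]]].
rewrite !inE => j1i0 ki0.
(* The l j with j != i0 are linear coordinates modulo e. *)
pose l j (z : V) := z 0 j * e 0 i0 - z 0 i0 * e 0 j.
have lL j : scalar (l j) by move=> t x y /=; rewrite /l !mxE; ring.
have lE j t x y : l j (t *: x + y) = t * l j x + l j y by exact: lL.
have lq j x y t : l j (Phi (x + t *: y)) =
    l j (Phi x) + t * l j (B x y) + t ^+ 2 * l j (Phi y).
  by rewrite (quadE PhiB) /l !mxE; ring.
have par z j m : l j z * l m (Phi z) = l m z * l j (Phi z).
  have [p [q [s [nz E]]]] := row_free_mx3Pn (dep e z).
  have F i : q * l i z + s * l i (Phi z) = 0.
    have := congr1 (l i) E; rewrite quad_unit Be /l !mxE => F.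
    by apply: (eq_of_eqB F); ring.
  have [s0|s0] := eqVneq s 0.
    have [q0|q0] := eqVneq q 0.
      move: E; rewrite q0 s0 !scale0r !addr0 quad_unit scalerA => /eqP.
      rewrite scaler_eq0 (negPf unit_neq0) orbF mulf_eq0 invr_eq0 pnatr_eq0 orbF.
      by move=> /eqP p0; move: nz; rewrite p0 q0 s0 eqxx.
    have G i : l i z = 0.
      by apply: (mulfI q0); rewrite mulr0 -[RHS](F i) s0 mul0r addr0.
    by rewrite !G !mul0r.
  have G : l j z * (q * l m z + s * l m (Phi z)) =
      l m z * (q * l j z + s * l j (Phi z)) by rewrite !F !mulr0.
  by apply: (mulfI s0); apply: (eq_of_eqB G); ring.
pose u : V := (e 0 i0)^-1 *: delta_mx 0 j1.
have lu : l j1 u = 1.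
  rewrite /l !mxE !eqxx [i0 == _]eq_sym (negPf j1i0) /=; by field.
(* Moving [z] along [v] stays in [l j1 = 0] while [l k] becomes a nonzero polynomial in t, which
   [par] then allows to cancel. *)
have l0 z : l j1 z = 0 -> l j1 (Phi z) = 0.
  move=> lz.
  pose v : V := delta_mx 0 k.
  have lkv : l k v = e 0 i0.
    by rewrite /l !mxE !eqxx [i0 == _]eq_sym (negPf ki0) /=; ring.
  have lj1v : l j1 v = 0.
    rewrite /l !mxE !eqxx [i0 == _]eq_sym (negPf ki0) (negPf j1k) /=; ring.
  have /(congr1 (fun p : {poly K} => p`_0)) :
      Poly [:: l j1 (Phi z); l j1 (B z v); l j1 (Phi v)] = 0.
    apply: (@mul_fun_eq0 _ (Poly [:: l k z; l k v])).
      apply: contraNneq ei0 => /(congr1 (fun r : {poly K} => r`_1)).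
      by rewrite coef_Poly coef0 /= lkv => ->.
    move=> t; rewrite !horner_Poly /=.
    have := par (z + t *: v) k j1.
    rewrite !lq -!(addrC (t *: v)) !lE lz lj1v mulr0 addr0 mul0r => E.
    by apply: (eq_of_eqB E); ring.
  by rewrite coef_Poly coef0.
pose beta z := l j1 (B z u) - l j1 z * l j1 (Phi u).
have betaL : scalar beta.
  move=> t x y /=.
  by rewrite /beta (polarC PhiB) (polarPr PhiB) !(polarC PhiB u) !lE; ring.
have bE t x y : beta (t *: x + y) = t * beta x + beta y by exact: betaL.
have lj1 z : l j1 (Phi z) = l j1 z * beta z.
  exact: (quad_form_factor _ (lq j1) (lL j1) lu l0).
(* Along [z + t *: u] the value of [l j1] is [l j1 z + t], a nonzero polynomial that cancels from
   [par]. *)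
have lj j z : l j (Phi z) = l j z * beta z.
  apply/eqP; rewrite -subr_eq0; apply/eqP.
  pose c1 := l j (B z u) - l j u * beta z - l j z * beta u.
  pose c2 := l j (Phi u) - l j u * beta u.
  have /(congr1 (fun p : {poly K} => p`_0)) :
      Poly [:: l j (Phi z) - l j z * beta z; c1; c2] = 0.
    apply: (@mul_fun_eq0 _ (Poly [:: l j1 z; 1])).
      apply/eqP => /(congr1 (fun r : {poly K} => r`_1)).
      by rewrite coef_Poly coef0 /= => /eqP; rewrite oner_eq0.
    move=> t; rewrite !horner_Poly /=.
    have := par (z + t *: u) j1 j.
    rewrite lj1 !lq -!(addrC (t *: u)) !lE bE lu => E.
    by apply: (eq_of_eqB E); rewrite /c1 /c2; ring.
  by rewrite coef_Poly coef0.
exists beta, (fun z => (Phi z - beta z *: z) 0 i0 / e 0 i0); split => //.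
  by rewrite /beta Be lu /l; ring.
move=> z; apply/rowP => j; rewrite !mxE.
have := lj j z; rewrite /l => E.
by apply: (mulfI ei0); apply: (eq_of_eqB E); field.
Qed.

(** The function [alpha] is a quadratic form vanishing on the kernel of [beta], hence divisible by
    [beta]; the normalization [Be] determines the quotient as [- beta z / 2]. *)
Lemma common_factor : exists2 beta : V -> K, scalar beta &
  forall z, Phi z = beta z *: (z - (beta z / 2) *: e).
Proof.
have [beta [alpha [betaL be PhiE]]] := common_factor_mod.
have bE t x y : beta (t *: x + y) = t * beta x + beta y by exact: betaL.
have b0 : beta 0 = 0.
  have := bE 1 0 0; rewrite scaler0 addr0 mul1r => /eqP.
  by rewrite -subr_eq0 opprD addNKr oppr_eq0 => /eqP.
have bD x y : beta (x + y) = beta x + beta y.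
  by rewrite -[x]scale1r bE mul1r scale1r.
have e0 := unit_neq0.
(* Otherwise [Phi x] is a nonzero multiple of [e]. For [y] outside the span of [e] and [x] with
   [beta y != 0], the vectors [B x y] and [Phi y] then bring in [x] and [y], against [dep]. *)
have alpha0 x : beta x = 0 -> alpha x = 0.
  move=> bx; apply/eqP; apply/negPn/negP => ax.
  have xe c : x != c *: e.
    apply: contraNneq ax => xE; have c0 : c = 0.
      by move: bx; rewrite xE -[_ *: e]addr0 bE b0 be mulr1 addr0.
    have := PhiE x; rewrite xE c0 scale0r (quad0 PhiB) scaler0 add0r => /esym/eqP.
    by rewrite scaler_eq0 (negPf e0) orbF.
  have [y ysub] : exists y : V, ~~ (y <= col_mx e x)%MS.
    have /row_subPn[i Hi] : ~~ (1%:M <= col_mx e x)%MS.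
      rewrite sub1mx /row_full; apply: contraTneq n_ge3 => /= E.
      by rewrite -leqNgt -E rank_leq_row.
    by exists (row i 1%:M).
  have /andP[es xs] : (e <= col_mx e x)%MS && (x <= col_mx e x)%MS.
    by rewrite -col_mx_sub.
  (* Adding [e] to [y] keeps it outside the span and raises [beta y] by 1. *)
  wlog by0 : y ysub / beta y != 0.
    move=> W; have [y0|] := eqVneq (beta y) 0; last exact: W.
    apply: (W (y + e)); last by rewrite bD y0 be add0r oner_neq0.
    by apply: contra ysub => H; rewrite -[y](addrK e) addmx_sub // eqmx_opp.
  pose d := alpha (x + y) - alpha y - alpha x.
  have Bxy : B x y = beta y *: x + d *: e.
    have := quadE PhiB x y 1; rewrite scale1r !PhiE bD bx => E.
    apply/rowP => i; move/rowP: E => /(_ i); rewrite !mxE => E.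
    by apply: (eq_of_eqB (esym E)); rewrite /d; ring.
  have [p [q [s [nz E]]]] := row_free_mx3Pn (dep x y).
  have [s0|s0] := eqVneq s 0.
    have [q0|q0] := eqVneq q 0.
      move: E; rewrite q0 s0 !scale0r !addr0 PhiE bx scale0r add0r scalerA.
      move=> /eqP; rewrite scaler_eq0 (negPf e0) orbF mulf_eq0 (negPf ax) orbF.
      by move=> /eqP p0; move: nz; rewrite p0 q0 s0 eqxx.
    have [] := negP (xe (- (q * beta y)^-1 * (p * alpha x + q * d))).
    apply/eqP/rowP => i; move/rowP: E => /(_ i); rewrite Bxy PhiE bx s0 !mxE => E.
    apply: (mulfI q0); apply: (mulfI by0); apply: (eq_of_eqB E); field.
    by rewrite by0 q0.
  case/negP: ysub.
  have -> : y = - (s * beta y)^-1 *: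
      ((p * alpha x + q * d + s * alpha y) *: e + (q * beta y) *: x).
    apply/rowP => i; move/rowP: E => /(_ i); rewrite Bxy !PhiE bx !mxE => E.
    apply: (mulfI s0); apply: (mulfI by0); apply: (eq_of_eqB E); field.
    by rewrite by0 s0.
  by rewrite scalemx_sub // addmx_sub // scalemx_sub.
exists beta => // z.
have [i0 ei0] : exists i, e 0 i != 0.
  apply/existsP; apply: contraR e0; rewrite negb_exists => /forallP h.
  by apply/eqP/rowP => i; rewrite mxE; apply/eqP; have := h i; rewrite negbK.
have aE x : alpha x = (Phi x - beta x *: x) 0 i0 / e 0 i0.
  by rewrite PhiE addrAC subrr add0r mxE mulfK.
pose b x y := (B x y - beta x *: y - beta y *: x) 0 i0 / e 0 i0.
have aq x y t : alpha (x + t *: y) = alpha x + t * b x y + t ^+ 2 * alpha y.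
  rewrite !aE /b (quadE PhiB) -[x + t *: y]addrC bE !mxE; ring.
rewrite PhiE (quad_form_factor z aq betaL be alpha0) /b (polarC PhiB z) Be be.
have -> : alpha e = - 1 / 2.
  by rewrite aE be quad_unit !mxE; field.
by apply/rowP => i; rewrite !mxE; field.
Qed.

End CommonFactor.

(** * Density *)

Section PolynomialOnLines.
Variables (K : numFieldType) (U : lmodType K).

(** Being polynomial on each line is all that a density argument needs, and it passes through sums,
    products and determinants without exhibiting multivariate polynomials. *)
Definition poly_on_lines (f : U -> K) :=
  forall u v, exists p : {poly K}, forall t, f (u + t *: v) = p.[t].

Lemma poly_on_lines_cst c : poly_on_lines (fun=> c).
Proof. by move=> u v; exists c%:P => t; rewrite hornerC. Qed.

Lemma poly_on_linesD f g :
  poly_on_lines f -> poly_on_lines g -> poly_on_lines (fun u => f u + g u).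
Proof.
move=> hf hg u v; have [p E] := hf u v; have [q F] := hg u v.
by exists (p + q) => t; rewrite hornerD E F.
Qed.

Lemma poly_on_linesM f g :
  poly_on_lines f -> poly_on_lines g -> poly_on_lines (fun u => f u * g u).
Proof.
move=> hf hg u v; have [p E] := hf u v; have [q F] := hg u v.
by exists (p * q) => t; rewrite hornerM E F.
Qed.

Lemma poly_on_lines_eq f g : f =1 g -> poly_on_lines f -> poly_on_lines g.
Proof. by move=> fg hf u v; have [p E] := hf u v; exists p => t; rewrite -fg. Qed.

Lemma poly_on_lines_sum I (r : seq I) (P : pred I) (F : I -> U -> K) :
  (forall i, poly_on_lines (F i)) ->
  poly_on_lines (fun u => \sum_(i <- r | P i) F i u).
Proof.
move=> hF; elim: r => [|i r IH].
  by apply: poly_on_lines_eq (poly_on_lines_cst 0) => u; rewrite big_nil.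
have [Pi|Pi] := boolP (P i).
  by apply: poly_on_lines_eq (poly_on_linesD (hF i) IH) => u; rewrite big_cons Pi.
by apply: poly_on_lines_eq IH => u; rewrite big_cons (negPf Pi).
Qed.

Lemma poly_on_lines_prod I (r : seq I) (P : pred I) (F : I -> U -> K) :
  (forall i, poly_on_lines (F i)) ->
  poly_on_lines (fun u => \prod_(i <- r | P i) F i u).
Proof.
move=> hF; elim: r => [|i r IH].
  by apply: poly_on_lines_eq (poly_on_lines_cst 1) => u; rewrite big_nil.
have [Pi|Pi] := boolP (P i).
  by apply: poly_on_lines_eq (poly_on_linesM (hF i) IH) => u; rewrite big_cons Pi.
by apply: poly_on_lines_eq IH => u; rewrite big_cons (negPf Pi).
Qed.

Lemma poly_on_lines_det m (F : 'I_m -> 'I_m -> U -> K) :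
  (forall i j, poly_on_lines (F i j)) ->
  poly_on_lines (fun u => \det (\matrix_(i, j) F i j u)).
Proof.
move=> hF.
apply: (poly_on_lines_eq (f := fun u =>
    \sum_(s : 'S_m) (-1) ^+ s * \prod_i F i (s i) u)).
  move=> u; apply: eq_bigr => s _; congr (_ * _).
  by apply: eq_bigr => i _; rewrite mxE.
apply: poly_on_lines_sum => s; apply: poly_on_linesM (poly_on_lines_cst _) _.
exact: poly_on_lines_prod.
Qed.

(** On the line from [u] to [u0] the function [f] is a nonzero polynomial, so [g] is the zero
    polynomial there. *)
Lemma poly_on_lines_mul_eq0 f g u0 : poly_on_lines f -> poly_on_lines g ->
  f u0 != 0 -> (forall u, f u != 0 -> g u = 0) -> forall u, g u = 0.
Proof.
move=> hf hg f0 fg u; have [p E] := hf u (u0 - u); have [q F] := hg u (u0 - u).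
have p0 : p != 0.
  apply: contraNneq f0 => p0.
  have u0E : u0 = u + 1 *: (u0 - u) by rewrite scale1r addrC subrK.
  by rewrite {1}u0E E p0 horner0.
have q0 : q = 0.
  apply: (mul_fun_eq0 p0) => t; rewrite -E -F.
  have [->|/fg ->] := eqVneq (f (u + t *: (u0 - u))) 0; first by rewrite mul0r.
  by rewrite mulr0.
by have := F 0; rewrite q0 horner0 scale0r addr0.
Qed.

End PolynomialOnLines.

Section GenericIdentity.
Variables (K : numFieldType) (n : nat).
Local Notation V := 'rV[K]_n.

Lemma poly_on_lines_linear (U : lmodType K) (g : U -> V) i :
  (forall u v t, g (u + t *: v) = g u + t *: g v) ->
  poly_on_lines (fun u => g u 0 i).
Proof.
move=> gL u v; exists (Poly [:: g u 0 i; g v 0 i]) => t.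
by rewrite horner_Poly /= gL !mxE; ring.
Qed.

Lemma poly_on_lines_polar (U : lmodType K) (phi : V -> V) (B : V -> V -> V)
    (f g : U -> V) : quadratic_map phi B ->
  (forall i, poly_on_lines (fun u => f u 0 i)) ->
  (forall i, poly_on_lines (fun u => g u 0 i)) ->
  forall i, poly_on_lines (fun u => B (f u) (g u) 0 i).
Proof.
move=> phiB hf hg i.
have E x y : B x y 0 i =
    \sum_j \sum_k x 0 j * (y 0 k * B (delta_mx 0 j) (delta_mx 0 k) 0 i).
  have L z w : B z w = \sum_k w 0 k *: B z (delta_mx 0 k).
    rewrite {1}[w]row_sum_delta (big_morph (B z) (polarDr phiB z) (polar0r phiB z)).
    by apply: eq_bigr => k _; rewrite (polarZr phiB).
  rewrite (polarC phiB) L summxE; apply: eq_bigr => j _.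
  rewrite mxE (polarC phiB) L summxE mulr_sumr; apply: eq_bigr => k _.
  by rewrite mxE.
apply: poly_on_lines_eq (fun u => esym (E _ _)) _.
apply: poly_on_lines_sum => j; apply: poly_on_lines_sum => k.
apply: poly_on_linesM (hf j) _; apply: poly_on_linesM (hg k) _.
exact: poly_on_lines_cst.
Qed.

Lemma poly_on_lines_quad (U : lmodType K) (phi : V -> V) (B : V -> V -> V)
    (f : U -> V) : quadratic_map phi B ->
  (forall i, poly_on_lines (fun u => f u 0 i)) ->
  forall i, poly_on_lines (fun u => phi (f u) 0 i).
Proof.
move=> phiB hf i.
apply: poly_on_lines_eq (poly_on_linesM (poly_on_lines_cst 2^-1)
  (poly_on_lines_polar phiB hf hf i)) => u.
by rewrite (polar_diag phiB) mxE mulrA mulVf ?mul1r // pnatr_eq0.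
Qed.

Lemma poly_on_lines_cubic (U : lmodType K) (N : V -> K) N1 (g : U -> V) :
  cubic_form N N1 -> (forall u v t, g (u + t *: v) = g u + t *: g v) ->
  poly_on_lines (fun u => N (g u)).
Proof.
move=> NN1 gL u v.
exists (Poly [:: N (g u); N1 (g u) (g v); N1 (g v) (g u); N (g v)]) => t.
by rewrite gL (cubicE NN1) horner_Poly /=; ring.
Qed.

Variables (phi phi' : V -> V) (B B' : V -> V -> V).
Variables (N M : V -> K) (N1 M1 : V -> V -> K).
Hypothesis phiB : quadratic_map phi B.
Hypothesis phiB' : quadratic_map phi' B'.
Hypothesis NN1 : cubic_form N N1.
Hypothesis MM1 : cubic_form M M1.
Hypothesis phi'K : forall x, phi' (phi x) = N x *: x.
Hypothesis phiK : forall y, phi (phi' y) = M y *: y.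

Lemma norm_diff_quad a0 b0 y0 : N b0 != 0 ->
  row_free (mx3 (phi a0) (B a0 y0) (phi y0)) ->
  forall a y, N a != 0 -> M1 (phi a) (phi y) = N a * N1 y a.
Proof.
move=> Nb0 fr a y Na.
have L1 (u v : V * V) t : (u + t *: v).1 = u.1 + t *: v.1 by [].
have L2 (u v : V * V) t : (u + t *: v).2 = u.2 + t *: v.2 by [].
have p1 i := poly_on_lines_linear i L1; have p2 i := poly_on_lines_linear i L2.
(* A second difference expresses the derivative through values of [N], which are polynomial on
   lines. *)
have N1E x z : N1 z x = 2^-1 * (N (x + z) + N (x - z)) - N x.
  have := cubicE NN1 x z 1; have := cubicE NN1 x z (-1).
  by rewrite scaleN1r scale1r => -> ->; field.
(* By [quad_polar_polar] this is a coordinate of [(M1 (phi a) (phi y) - N a * N1 y a) *: phi a] at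
   [u = (a, y)], written without [M1] so as to be visibly polynomial. *)
pose D i (u : V * V) := (N u.1 *: B u.1 (B' (phi u.1) (phi u.2)) -
  N u.1 ^+ 2 *: phi u.2 - (N u.1 * N1 u.2 u.1) *: phi u.1) 0 i.
have pN1 : poly_on_lines (fun u : V * V => N u.1).
  exact: poly_on_lines_cubic NN1 L1.
have pN2 : poly_on_lines (fun u : V * V => N u.2).
  exact: poly_on_lines_cubic NN1 L2.
have pNM g : (forall (u v : V * V) t, g (u + t *: v) = g u + t *: g v) ->
  poly_on_lines (fun u => N (g u)) by exact: poly_on_lines_cubic NN1.
have q1 := poly_on_lines_quad phiB p1; have q2 := poly_on_lines_quad phiB p2.
have pD i : poly_on_lines (D i).
  apply: (poly_on_lines_eq (f := fun u =>
      N u.1 * B u.1 (B' (phi u.1) (phi u.2)) 0 i +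
      (-1 * (N u.1 * N u.1) * phi u.2 0 i +
       -1 * (N u.1 * (2^-1 * (N (u.1 + u.2) + N (u.1 - u.2)) + -1 * N u.1))
         * phi u.1 0 i))).
    by move=> u; rewrite /D N1E !mxE; ring.
  have q := poly_on_lines_polar phiB p1 (poly_on_lines_polar phiB' q1 q2).
  do ![exact: poly_on_lines_cst | exact: q1 | exact: q2 | exact: q | exact: pN1
    | apply: poly_on_linesD | apply: poly_on_linesM];
    apply: pNM => u v t; apply/rowP => j; rewrite !mxE; ring.
have [C MC] := row_freeP fr.
(* A determinant equal to 1 at [(a0, y0)] whose nonvanishing implies that the triple is free. *)
pose Delta (u : V * V) := \det (mx3 (phi u.1) (B u.1 u.2) (phi u.2) *m C).
have pDelta : poly_on_lines Delta.
  apply: (poly_on_lines_eq (f := fun u => \det (\matrix_(i, j) \sum_k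
      mx3 (phi u.1) (B u.1 u.2) (phi u.2) i k * C k j))).
    by move=> u; congr (\det _); apply/matrixP => i j; rewrite !mxE.
  apply: poly_on_lines_det => i j; apply: poly_on_lines_sum => k.
  apply: poly_on_linesM (poly_on_lines_cst _).
  apply: (poly_on_lines_eq (f := fun u =>
      (nth 0 [:: phi u.1; B u.1 u.2; phi u.2] i : V) 0 k)).
    by move=> u; rewrite mxE.
  case: i => [[|[|[|//]]] _] /=; [exact: q1| |exact: q2].
  exact: (poly_on_lines_polar phiB p1 p2).
(* The factors [Delta], [N u.2] and [N u.1] are each nonzero somewhere and are cancelled in turn;
   where none of them vanishes, [norm_diff_quad_free] applies. *)
have D0 i : D i (a, y) = 0.
  apply: (poly_on_lines_mul_eq0 (u0 := (a0, y0)) pDelta (pD i)).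
    by rewrite /Delta MC det1 oner_neq0.
  suff H u : Delta u * D i u = 0.
    by move=> u Du; apply: (mulfI Du); rewrite H mulr0.
  apply: (poly_on_lines_mul_eq0 (g := fun u => Delta u * D i u)
    (u0 := (b0, b0)) pN2) => //.
    exact: poly_on_linesM.
  move=> {}u Nu2; apply: (mulfI Nu2); rewrite mulr0; move: u {Nu2}.
  apply: (poly_on_lines_mul_eq0 (g := fun u => N u.2 * (Delta u * D i u))
    (u0 := (b0, b0)) pN1) => //.
    by apply: poly_on_linesM => //; apply: poly_on_linesM.
  move=> [c z] /= Nc; apply/eqP; rewrite mulf_eq0; apply/orP.
  have [Nz|Nz] := eqVneq (N z) 0; [by left|right].
  rewrite mulf_eq0; apply/orP.
  have [Dcz|Dcz] := eqVneq (Delta (c, z)) 0; [by left|right].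
  have fr' : row_free (mx3 (phi c) (B c z) (phi z)).
    apply/row_freeP; exists (C *m invmx (mx3 (phi c) (B c z) (phi z) *m C)).
    by rewrite mulmxA mulmxV // unitmxE unitfE.
  rewrite /D /= (quad_polar_polar phiB phiB' NN1 MM1 phi'K phiK).
  rewrite (norm_diff_quad_free phiB phiB' NN1 MM1 phi'K phiK Nc Nz fr').
  by apply/eqP; rewrite !mxE; ring.
suff /eqP : (M1 (phi a) (phi y) - N a * N1 y a) *: phi a = 0.
  rewrite scaler_eq0 (negPf (quad_neq0 phiB' NN1 phi'K Na)) orbF subr_eq0.
  by move=> /eqP.
apply/rowP => i; rewrite [RHS]mxE -(D0 i) /D /=.
rewrite (quad_polar_polar phiB phiB' NN1 MM1 phi'K phiK) !mxE; ring.
Qed.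
End GenericIdentity.

(** * The linear equivalence *)

(** Applying [B' (phi a)] to the equation forces [y] to be a multiple of [a]; substituting back
    leaves [N1 a y *: phi a = 0]. *)
Lemma conformal_ker (K : numFieldType) (n : nat)
    (phi phi' : 'rV[K]_n -> 'rV[K]_n) (B B' : 'rV[K]_n -> 'rV[K]_n -> 'rV[K]_n)
    (N : 'rV[K]_n -> K) (N1 : 'rV[K]_n -> 'rV[K]_n -> K) a y :
  quadratic_map phi B -> quadratic_map phi' B' -> cubic_form N N1 ->
  (forall x, phi' (phi x) = N x *: x) -> N a != 0 ->
  N1 a y *: phi a - N a *: B a y = 0 -> y = 0.
Proof.
move=> phiB phiB' NN1 phi'K Na E.
have yE : y = (N1 a y / N a) *: a.
  have := congr1 (B' (phi a)) E.
  rewrite (polarDr phiB') -scaleNr !(polarZr phiB') (polar0r phiB').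
  rewrite (polar_diag phiB') phi'K (inverse_expansion phiB phiB' NN1 phi'K a y).1.
  move=> F; apply/rowP => i; move/rowP: F => /(_ i); rewrite !mxE => F.
  apply: (mulfI Na); apply: (mulfI Na); apply: (eq_of_eqB (esym F)); by field.
move: E; rewrite {2}yE (polarZr phiB) (polar_diag phiB) => E.
have : N1 a y *: phi a = 0.
  apply/rowP => i; move/rowP: E => /(_ i); rewrite !mxE => F.
  by apply: (eq_of_eqB (esym F)); field.
move=> /eqP; rewrite scaler_eq0 (negPf (quad_neq0 phiB' NN1 phi'K Na)) orbF.
by move=> /eqP N10; rewrite yE N10 mul0r scale0r.
Qed.

Section LinearEquivalence.
Variables (K : numFieldType) (n : nat).
Local Notation V := 'rV[K]_n.
Variables (phi phi' : V -> V) (B B' : V -> V -> V).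
Variables (N M : V -> K) (N1 M1 : V -> V -> K).
Hypothesis n_ge3 : (3 <= n)%N.
Hypothesis phiB : quadratic_map phi B.
Hypothesis phiB' : quadratic_map phi' B'.
Hypothesis NN1 : cubic_form N N1.
Hypothesis MM1 : cubic_form M M1.
Hypothesis phi'K : forall x, phi' (phi x) = N x *: x.
Hypothesis phiK : forall y, phi (phi' y) = M y *: y.
Hypothesis phi_nofactor : forall (beta : V -> K) (Lambda : V -> V),
  scalar beta -> linear Lambda -> ~ (forall y, phi y = beta y *: Lambda y).

Lemma norm_diff_linear a : N a != 0 -> scalar (M1 (phi a)).
Proof.
move=> Na t x y.
apply: (cubic_diff_linear phiB' phiB MM1 phiK).
by rewrite (norm_quad phiB phiB' NN1 MM1 phi'K phiK) expf_neq0.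
Qed.

Lemma not_all_dependent a : N a != 0 ->
  ~ (forall x y, ~~ row_free (mx3 (phi x) (B x y) (phi y))).
Proof.
move=> Na dep.
have ML t x y : M1 (phi a) (t *: x + y) = t * M1 (phi a) x + M1 (phi a) y.
  exact: norm_diff_linear.
(* S inverts B a, so that e = B a a satisfies B (S e) (S z) = z. *)
pose S w := (N a)^-1 *: (B' (phi a) w - (M1 (phi a) w / (2 * N a)) *: a).
have SL t x y : S (t *: x + y) = t *: S x + S y.
  rewrite /S (polarPr phiB') ML; apply/rowP => i; rewrite !mxE; by field.
have BS w : B a (S w) = w.
  rewrite (polarZr phiB) -scaleNr (polarDr phiB) (polarZr phiB) (polar_diag phiB).
  apply: (scalerI Na); apply: (scalerI Na).
  have := quad_polar_polar phiB phiB' NN1 MM1 phi'K phiK a w => E.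
  apply/rowP => i; move/rowP: E => /(_ i); rewrite !mxE => F.
  by apply: (eq_of_eqB F); field.
have SB y : S (B a y) = y.
  rewrite /S (inverse_expansion phiB phiB' NN1 phi'K a y).1.
  rewrite (norm_diff_polar phiB phiB' NN1 MM1 phi'K phiK) //.
  by apply/rowP => i; rewrite !mxE; field.
have PhiB : quadratic_map (phi \o S) (fun x y => B (S x) (S y)).
  split=> [x y t|x y|x t y z] /=.
  - by rewrite addrC SL addrC (quadE phiB).
  - exact: (polarC phiB).
  - by rewrite SL (polarPr phiB).
have [||beta betaL E] := common_factor n_ge3 (e := B a a) PhiB.
- by move=> z; rewrite SB BS.
- by move=> x y; exact: dep.
have bE t x y : beta (t *: x + y) = t * beta x + beta y by exact: betaL.
apply: (@phi_nofactor (fun y => beta (B a y))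
  (fun y => B a y - (beta (B a y) / 2) *: B a a)).
- by move=> t x y; rewrite (polarPr phiB) bE.
- move=> t x y; rewrite (polarPr phiB) bE; apply/rowP => i; rewrite !mxE; by field.
by move=> y; rewrite -E /= SB.
Qed.

Lemma norm_diff_quad_all a y : N a != 0 -> M1 (phi a) (phi y) = N a * N1 y a.
Proof.
move=> Na; apply/eqP/negPn/negP => D; apply: (not_all_dependent Na) => x z.
apply: contra D => fr; apply/eqP.
exact: (norm_diff_quad phiB phiB' NN1 MM1 phi'K phiK Na fr).
Qed.

(* A is -N(a)^2 times the differential at a of the inversion phi / N. *)
Lemma linear_equivalence a : N a != 0 -> exists A L : V -> V,
  [/\ linear A, linear L, forall y, A y = 0 -> y = 0, forall w, L w = 0 -> w = 0
    & forall y, phi' (A y) = L (phi y)].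
Proof.
move=> Na.
have ML t x y : M1 (phi a) (t *: x + y) = t * M1 (phi a) x + M1 (phi a) y.
  exact: norm_diff_linear.
have Mphi := norm_quad phiB phiB' NN1 MM1 phi'K phiK a.
exists (fun y => N1 a y *: phi a - N a *: B a y).
exists (fun w => M1 (phi a) w *: phi' (phi a) - M (phi a) *: B' (phi a) w).
split.
- move=> t x y; rewrite (cubic_diff_linear phiB phiB' NN1 phi'K Na) (polarPr phiB).
  by apply/rowP => i; rewrite !mxE; ring.
- move=> t x y; rewrite ML (polarPr phiB').
  by apply/rowP => i; rewrite !mxE; ring.
- by move=> y; exact: (conformal_ker phiB phiB' NN1 phi'K Na).
- by move=> w; apply: (conformal_ker phiB' phiB MM1 phiK); rewrite Mphi expf_neq0.
(* In the expansion of [phi' (A y)], the second part of [inverse_expansion] replaces [phi' (B a y)].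
   The terms in [y] cancel, leaving multiples of [a] and [B' (phi a) (phi y)]. *)
move=> y; rewrite -scaleNr (quadE phiB') (quadZ phiB') (polarZl phiB').
have [-> E] := inverse_expansion phiB phiB' NN1 phi'K a y.
rewrite phi'K Mphi norm_diff_quad_all //.
apply/rowP => i; move/rowP: E => /(_ i); rewrite !mxE => E.
have := congr1 (fun z => N a ^+ 2 * z) E => F.
by apply: (eq_of_eqB F); ring.
Qed.

End LinearEquivalence.

(** * Homogeneous polynomials *)

Section Homogeneous.
Variables (K : numFieldType) (n : nat).
Local Notation P := {mpoly K[n]}.
Local Notation V := 'rV[K]_n.

Definition mfun (p : P) (x : V) : K := p.@[fun i => x 0 i].

Lemma mfun_eq (p q : P) : mfun p =1 mfun q -> p = q.
Proof.
move=> E; apply/eqP; rewrite -subr_eq0; apply/eqP/mpoly_fun_eq0 => v.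
have R r : mfun r (\row_i v i) = r.@[v] by apply: meval_eq => i; rewrite mxE.
by rewrite mevalB -!R E subrr.
Qed.

Lemma dhomog0_const (p : P) : p \is 0.-homog -> p = (p@_0%MM)%:MP.
Proof.
move=> hp; apply/mpolyP => m; rewrite mcoeffC; have [->|m0] := eqVneq m 0%MM.
  by rewrite mulr1.
by rewrite mulr0 (dhomog_nemf_coeff hp) // mdeg_eq0.
Qed.

Lemma mdeg_subU d i (m : 'X_{1..n}) :
  (U_(i) <= m)%MM -> mdeg m = d.+1 -> mdeg (m - U_(i))%MM = d.
Proof.
move=> im md; apply: succn_inj; rewrite -md.
by have := mdegD (m - U_(i)) U_(i); rewrite submK // mdeg1 addn1.
Qed.

(** The basis of the inductions on degree: each monomial is assigned to a single variable occurring
    in it. *)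
Lemma dhomogS_decomp d (p : P) : p \is d.+1.-homog ->
  exists q : 'I_n -> P, (forall i, q i \is d.-homog) /\ p = \sum_i q i * 'X_i.
Proof.
move=> hp; pose s (m : 'X_{1..n}) := [pick i | m i != 0%N].
exists (fun i => \sum_(m <- msupp p | s m == Some i) p@_m *: 'X_[m - U_(i)]).
have sP m i : s m == Some i -> (U_(i) <= m)%MM.
  by rewrite /s; case: pickP => // j mj /eqP[<-]; rewrite lep1mP.
split=> [i|].
  rewrite big_seq_cond; apply: rpred_sum => m /andP[mp /sP im].
  apply: dhomogZ; rewrite dhomogX; apply/eqP.
  exact: mdeg_subU im (dhomog_mf hp mp).
under eq_bigr do rewrite mulr_suml.
rewrite (exchange_big_dep xpredT) //= {1}[p]mpolyE big_seq [RHS]big_seq.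
apply: eq_bigr => m mp.
have [i si] : exists i, s m = Some i.
  rewrite /s; case: pickP => [i _|h]; first by exists i.
  have m0 : m = 0%MM.
    by apply/mnmP => i; rewrite mnm0E; apply/eqP; have := h i; move/negbFE.
  by have md : mdeg m = d.+1 := dhomog_mf hp mp; rewrite m0 mdeg0 in md.
rewrite (big_pred1 i) => [|j]; last by rewrite si eq_sym.
by rewrite -scalerAl -mpolyXD submK // sP // si.
Qed.

Lemma dhomog_mfunZ d (p : P) t x : p \is d.-homog ->
  mfun p (t *: x) = t ^+ d * mfun p x.
Proof.
elim: d p => [|d IH] p hp.
  by rewrite (dhomog0_const hp) /mfun !mevalC mul1r.
have [q [hq ->]] := dhomogS_decomp hp.
rewrite /mfun !raddf_sum mulr_sumr; apply: eq_bigr => i _ /=.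
rewrite !mevalM !mevalXU -!/(mfun _ _) IH // mxE exprS; ring.
Qed.

Lemma dhomog1_linear (p : P) t x y : p \is 1.-homog ->
  mfun p (x + t *: y) = mfun p x + t * mfun p y.
Proof.
move=> /dhomogS_decomp[q [hq ->]].
rewrite /mfun !raddf_sum mulr_sumr -big_split; apply: eq_bigr => i _ /=.
rewrite !mevalM !mevalXU (dhomog0_const (hq i)) !mevalC !mxE; ring.
Qed.

Lemma dhomog2_polar (p : P) : p \is 2.-homog -> exists b : V -> V -> K,
  [/\ forall x y t, mfun p (x + t *: y) = mfun p x + t * b x y + t ^+ 2 * mfun p y,
      forall x y, b x y = b y x
    & forall x t y z, b x (t *: y + z) = t * b x y + b x z].
Proof.
move=> /dhomogS_decomp[q [hq ->]].
exists (fun x y : V => \sum_i (mfun (q i) x * y 0 i + mfun (q i) y * x 0 i)).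
split=> [x y t|x y|x t y z].
- rewrite /mfun !raddf_sum !mulr_sumr -!big_split; apply: eq_bigr => i _ /=.
  rewrite !mevalM !mevalXU -!/(mfun _ _) dhomog1_linear // !mxE; ring.
- by apply: eq_bigr => i _; rewrite addrC.
rewrite mulr_sumr -big_split; apply: eq_bigr => i _ /=.
rewrite addrC addrC [t *: y + z]addrC dhomog1_linear // !mxE; ring.
Qed.

Lemma dhomog3_cubic (p : P) : p \is 3.-homog ->
  exists N1, cubic_form (mfun p) N1.
Proof.
move=> hp; have [q [hq E]] := dhomogS_decomp hp.
have {}hq i : exists b : V -> V -> K, forall x y t,
    mfun (q i) (x + t *: y) = mfun (q i) x + t * b x y + t ^+ 2 * mfun (q i) y.
  by have [b [H _ _]] := dhomog2_polar (hq i); exists b.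
(* Writing the polarization as a difference of values gives an explicit witness for the derivative,
   without choosing a [b] for every [i]. *)
have pol i x y : forall t, mfun (q i) (x + t *: y) = mfun (q i) x +
   t * (mfun (q i) (x + y) - mfun (q i) x - mfun (q i) y) + t ^+ 2 * mfun (q i) y.
  move=> t; have [b H] := hq i; rewrite H.
  by have := H x y 1; rewrite scale1r => ->; ring.
exists (fun x y : V => \sum_i (mfun (q i) x * y 0 i +
  (mfun (q i) (x + y) - mfun (q i) x - mfun (q i) y) * x 0 i)).
split=> [t x|x y t]; first exact: dhomog_mfunZ.
rewrite E /mfun !raddf_sum !mulr_sumr -!big_split; apply: eq_bigr => i _ /=.
by rewrite !mevalM !mevalXU -!/(mfun _ _) pol !mxE [y + x]addrC; ring.
Qed.

Definition tmap m (F : m.-tuple P) (x : V) : 'rV[K]_m := \row_i mfun (tnth F i) x.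

Lemma tmap_quadratic (F : n.-tuple P) : (forall i, tnth F i \is 2.-homog) ->
  quadratic_map (tmap F) (fun x y => tmap F (x + y) - tmap F x - tmap F y).
Proof.
move=> hF.
have pol i : exists b : V -> V -> K,
  [/\ forall x y t, mfun (tnth F i) (x + t *: y) =
        mfun (tnth F i) x + t * b x y + t ^+ 2 * mfun (tnth F i) y,
      forall x t y z, b x (t *: y + z) = t * b x y + b x z
    & forall x y, mfun (tnth F i) (x + y) - mfun (tnth F i) x
        - mfun (tnth F i) y = b x y].
  have [b [h1 h2 h3]] := dhomog2_polar (hF i); exists b; split=> // x y.
  by have := h1 x y 1; rewrite scale1r => ->; ring.
split=> [x y t|x y|x t y z].
- apply/rowP => i; have [b [h1 _ h2]] := pol i.
  by rewrite !mxE h2 h1.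
- by rewrite [x + y]addrC addrAC.
apply/rowP => i; have [b [_ h1 h2]] := pol i.
by rewrite !mxE !h2 h1.
Qed.

Lemma comp_dhomog m d e (p : P) (F : n.-tuple {mpoly K[m]}) :
  p \is d.-homog -> (forall i, tnth F i \is e.-homog) ->
  p \mPo F \is (d * e).-homog.
Proof.
move=> hp hF; elim: d p hp => [|d IH] p hp.
  rewrite (dhomog0_const hp) comp_mpolyC mul0n -[_%:MP]mulr1 mul_mpolyC.
  by apply: dhomogZ; exact: dhomog1.
have [q [hq ->]] := dhomogS_decomp hp.
rewrite raddf_sum /=; apply: rpred_sum => i _.
rewrite rmorphM /= comp_mpolyXU -tnth_nth mulSn addnC.
by apply: dhomogM; rewrite ?IH.
Qed.

Lemma mem_msupp_mulX (q : P) i m : m \in msupp (q * 'X_i) -> m i != 0%N.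
Proof.
rewrite (perm_mem (msuppMX q U_(i))) => /mapP[m' _ ->].
by rewrite mnmDE mnm1E eqxx.
Qed.

(** With a second index [j0], the relation [f i0 * 'X_j0 = f j0 * 'X_i0] shows that every monomial
    of [f i0] contains ['X_i0]; the quotient serves all indices. *)
Lemma proportional_to_coordinates d (f : 'I_n -> P) : (1 < n)%N ->
  (forall i, f i \is d.+1.-homog) ->
  (forall i j, f i * 'X_j = f j * 'X_i) ->
  exists2 N : P, N \is d.-homog & forall i, f i = N * 'X_i.
Proof.
move=> n1 hf E.
pose i0 : 'I_n := Ordinal (ltnW n1); pose j0 : 'I_n := Ordinal n1.
have im m : m \in msupp (f i0) -> (U_(i0) <= m)%MM.
  move=> mf; rewrite lep1mP.
  have : (m + U_(j0))%MM \in msupp (f j0 * 'X_i0).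
    by rewrite -E mcoeff_msupp addmC mcoeffMX -mcoeff_msupp.
  by move/mem_msupp_mulX; rewrite mnmDE mnm1E (_ : j0 == i0 = false) ?addn0.
pose N := \sum_(m <- msupp (f i0)) (f i0)@_m *: 'X_[m - U_(i0)] : P.
have fN : f i0 = N * 'X_i0.
  rewrite {1}[f i0]mpolyE mulr_suml big_seq [RHS]big_seq.
  by apply: eq_bigr => m mf; rewrite -scalerAl -mpolyXD submK ?im.
exists N.
  rewrite /N big_seq; apply: rpred_sum => m mf.
  apply: dhomogZ; rewrite dhomogX; apply/eqP.
  exact: mdeg_subU (im m mf) (dhomog_mf (hf i0) mf).
move=> j; have X0 : ('X_i0 : P) != 0 by rewrite -msupp_eq0 msuppX.
by apply: (mulIf X0); rewrite E fN; ring.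
Qed.

End Homogeneous.

(** * Projective equivalence *)

Section ProjectiveEquivalence.
Variables (K : numFieldType) (r : nat).
Local Notation P := {mpoly K[r.+1]}.
Local Notation V := 'rV[K]_r.+1.

Lemma linear_sum_delta (W : lmodType K) (f : V -> W) y : linear f ->
  f y = \sum_j y 0 j *: f (delta_mx 0 j).
Proof.
move=> fL; have f0 : f 0 = 0.
  have := fL 1 0 0; rewrite scaler0 addr0 scale1r => /eqP.
  by rewrite -subr_eq0 opprD addNKr oppr_eq0 => /eqP.
have fD : {morph f : x z / x + z} by move=> x z; rewrite -[x]scale1r fL !scale1r.
rewrite {1}[y]row_sum_delta (big_morph f fD f0); apply: eq_bigr => j _.
by rewrite -[_ *: delta_mx _ _]addr0 fL f0 addr0.
Qed.

(** The matrix acts on columns, as in [linear_pullback], although [f] acts on row vectors. *)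
Definition matrix_of (f : V -> V) : 'M[K]_r.+1 :=
  \matrix_(i, j) f (delta_mx 0 j) 0 i.

Lemma matrix_ofE (f : V -> V) y i : linear f ->
  f y 0 i = \sum_j matrix_of f i j * y 0 j.
Proof.
move=> fL; rewrite (linear_sum_delta y fL) summxE; apply: eq_bigr => j _.
by rewrite !mxE mulrC.
Qed.

Lemma matrix_of_unit (f : V -> V) : linear f -> (forall y, f y = 0 -> y = 0) ->
  matrix_of f \in unitmx.
Proof.
move=> fL f0; rewrite -unitmx_tr -row_free_unit; apply: inj_row_free => y yf.
apply: f0; rewrite -yf; apply/rowP => i; rewrite matrix_ofE // mxE.
by apply: eq_bigr => j _; rewrite !mxE mulrC.
Qed.

Lemma chart_ideal_comb m n (F : m.-tuple P) (G : n.-tuple P)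
    (C : 'M[K]_(n, m)) i f :
  (forall k, tnth G k = \sum_l C k l *: tnth F l) ->
  chart_ideal G i f -> chart_ideal F i f.
Proof.
move=> GF [c ->]; exists (fun l => \sum_k C k l *: c k).
under [RHS]eq_bigr do rewrite mulr_suml.
rewrite exchange_big; apply: eq_bigr => k _ /=.
rewrite GF /dehomog raddf_sum mulr_sumr; apply: eq_bigr => l _ /=.
by rewrite comp_mpolyZ -scalerAr -scalerAl.
Qed.

(** Constant linear combinations survive dehomogenization, and [invmx C] gives the reverse inclusion
    of ideals. *)
Lemma same_subscheme_comb m (F G : m.-tuple P) (C : 'M[K]_m) : C \in unitmx ->
  (forall k, tnth G k = \sum_l C k l *: tnth F l) -> same_subscheme F G.
Proof.
move=> Cu GF i f; split; last exact: chart_ideal_comb GF.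
apply: (chart_ideal_comb (C := invmx C)) => k.
under eq_bigr do rewrite GF scaler_sumr.
rewrite exchange_big /=.
transitivity (\sum_l (1%:M : 'M[K]_m) k l *: tnth F l).
  rewrite (bigD1 k) //= mxE eqxx scale1r big1 ?addr0 // => l lk.
  by rewrite mxE eq_sym (negPf lk) scale0r.
apply: eq_bigr => l _; rewrite -(mulVmx Cu) mxE scaler_suml.
by apply: eq_bigr => j _; rewrite scalerA.
Qed.

Lemma mfun_comp m (p : {mpoly K[m]}) (F : m.-tuple P) x :
  mfun (p \mPo F) x = mfun p (tmap F x).
Proof.
by rewrite /mfun comp_mpoly_meval; apply: meval_eq => i; rewrite mxE.
Qed.

Lemma composition_norm d (phi phi' : (r.+1).-tuple P) : (0 < r)%N ->
  (forall i, tnth (rat_map_comp phi' phi) i \is d.+1.-homog) ->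
  rat_map_eq (rat_map_comp phi' phi) (rat_map_id K r) ->
  exists N : P, [/\ N \is d.-homog, N != 0 &
    forall x, tmap phi' (tmap phi x) = mfun N x *: x].
Proof.
move=> r0 hom [[i fi0] _ E].
have [|//||N hN NE] := @proportional_to_coordinates K r.+1 d
    (fun i => tnth (rat_map_comp phi' phi) i).
- by [].
- by move=> k l; have := E k l; rewrite !tnth_mktuple.
exists N; split=> //; first by apply: contraNneq fi0 => N0; rewrite NE N0 mul0r.
move=> x; apply/rowP => k; rewrite !mxE -mfun_comp.
by have := NE k; rewrite tnth_mktuple => ->; rewrite /mfun mevalM mevalXU.
Qed.

(** The linear form would be a common divisor, hence a unit, but its value at the origin is 0. *)
Lemma reduced_no_linear_factor d (phi : (r.+1).-tuple P)
    (beta : V -> K) (Lambda : V -> V) :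
  reduced_forms d phi -> scalar beta -> linear Lambda ->
  ~ (forall y, tmap phi y = beta y *: Lambda y).
Proof.
move=> [_ red] bL LL E.
pose g : P := \sum_j beta (delta_mx 0 j) *: 'X_j.
have gE y : mfun g y = beta y.
  rewrite (linear_sum_delta (W := K^o) y bL) /mfun raddf_sum; apply: eq_bigr => j _.
  by rewrite /= mevalZ mevalXU mulrC.
have : g \is a GRing.unit.
  apply: red => i; exists (\sum_j matrix_of Lambda i j *: 'X_j).
  apply: mfun_eq => y; have /rowP/(_ i) := E y; rewrite !mxE => ->.
  rewrite [RHS]/mfun mevalM -!/(mfun _ _) gE mulrC; congr (_ * _).
  rewrite matrix_ofE // /mfun raddf_sum; apply: eq_bigr => j _.
  by rewrite /= mevalZ mevalXU.
move=> /(rmorph_unit (meval (fun=> 0))) /=.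
suff -> : g.@[fun=> 0] = 0 by rewrite unitr0.
by rewrite raddf_sum big1 // => j _; rewrite /= mevalZ mevalXU mulr0.
Qed.

Lemma quadro_quadric_equivalence (phi phi' : (r.+1).-tuple P) : (2 <= r)%N ->
  cremona_bidegree 2 2 phi phi' -> projectively_equivalent phi phi'.
Proof.
move=> r2 [red red' [inv inv']].
have [hphi _] := red; have [hphi' _] := red'.
have r0 : (0 < r)%N by exact: ltnW.
(* The composite has degree 2 * 2 = 4 and equals [N] times the coordinates, so [N] is a cubic
   form. *)
have [|N [hN N0 phi'K]] := @composition_norm 3 phi phi' r0 _ inv.
  by move=> i; rewrite tnth_mktuple; exact: (comp_dhomog (hphi' i) hphi).
have [|M [hM M0 phiK]] := @composition_norm 3 phi' phi r0 _ inv'.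
  by move=> i; rewrite tnth_mktuple; exact: (comp_dhomog (hphi i) hphi').
have [N1 NN1] := dhomog3_cubic hN; have [M1 MM1] := dhomog3_cubic hM.
have phiB := tmap_quadratic hphi; have phiB' := tmap_quadratic hphi'.
have [a Na] : exists a, mfun N a != 0.
  apply: contrapT => h; case/eqP: N0; apply: mfun_eq => a.
  rewrite [RHS]/mfun meval0; apply/eqP/negPn/negP => Na.
  by apply: h; exists a.
have [A [L [AL LL A0 L0 E]]] := linear_equivalence (r2 : (3 <= r.+1)%N)
  phiB phiB' NN1 MM1 phi'K phiK (fun _ _ bL LL => reduced_no_linear_factor red bL LL) Na.
exists (matrix_of A); first exact: matrix_of_unit.
(* The identity [phi' (A x) = L (phi x)] says that the pulled-back forms are the combinations of
   [phi] given by the matrix of [L]. *)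
apply: (@same_subscheme_comb _ _ _ (matrix_of L)); first exact: matrix_of_unit.
move=> k; rewrite tnth_mktuple; apply: mfun_eq => x.
rewrite mfun_comp.
have -> : tmap [tuple \sum_j matrix_of A i j *: 'X_j | i < r.+1] x = A x.
  apply/rowP => i; rewrite mxE tnth_mktuple matrix_ofE // /mfun raddf_sum.
  by apply: eq_bigr => j _; rewrite /= mevalZ mevalXU.
have /rowP/(_ k) := E x; rewrite mxE => ->; rewrite matrix_ofE //.
rewrite /mfun raddf_sum; apply: eq_bigr => l _.
by rewrite /= mevalZ [tmap _ _ _ _]mxE.
Qed.

End ProjectiveEquivalence.

Unset Implicit Arguments.

Theorem corollary5p3 (R : realType) (r : nat)
    (phi phi' : (r.+1).-tuple {mpoly R[i][r.+1]}) :
  (2 <= r)%N ->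
  cremona_bidegree 2 2 phi phi' ->
  projectively_equivalent phi phi'.
Proof. exact: quadro_quadric_equivalence. Qed.
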